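(* Let $A\subseteq\omega$ be an infinite c.e. set, $n\ge1$, and let $\theta^{(n)}$ be a quasi-Gödel numbering of $\mathcal S^{(n)}_A$. Then there is no function $q\in\mathcal R^{(1)}$ such that for all $i\in\omega$: if $\theta^{(n)}_i\in\mathrm{Anf}^{(n)}_A$, then $\theta^{(n)}_{q(i)}\in\mathcal R^{(n)}$ and $\mathrm{graph}(\theta^{(n)}_i)\subset\mathrm{graph}(\theta^{(n)}_{q(i)})$.
   Context: $\omega$ is the set of natural numbers; $\mathcal R^{(n)}$ is the set of total computable functions $\omega^n\to\omega$. $\langle\cdot,\cdot\rangle:\omega^2\to\omega$ is a computable bijection with $\langle x,y\rangle\ge x,y$, extended by $\langle x\rangle=x$, $\langle x_1,\dots,x_{n+1}\rangle=\langle x_1,\langle x_2,\dots,x_{n+1}\rangle\rangle$. $\mathrm{Anf}^{(n)}_A$ is the set of partial functions from $\omega^n$ to $\omega$ whose domain is either empty or equal to $\{0,\dots,a-1\}^n$ for some $a\in A$, and $\mathcal S^{(n)}_A=\mathcal R^{(n)}\cup\mathrm{Anf}^{(n)}_A$. For an $n$-ary partial function $q$, $\mathrm{graph}(q)=\{\langle\langle\vec x\rangle,q(\vec x)\rangle:\vec x\in\mathrm{dom}(q)\}$, and the extended graph of $q$ is $\{\langle\langle\vec y\rangle,0\rangle:\vec y\in\omega^n\}\cup\{\langle\langle\vec x\rangle,q(\vec x)+1\rangle:\vec x\in\mathrm{dom}(q)\}$. A numbering of a set $X$ is a surjection $\omega\to X$. A numbering $\theta$ of $\mathcal S^{(n)}_A$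 is a quasi-Gödel numbering if: (QGN I) the extended graph of $(i,\vec x)\mapsto\theta_i(\vec x)$ is the range of a function in $\mathcal R^{(1)}$; and (QGN II) for every $k\in\mathcal R^{(2)}$ there is $v\in\mathcal R^{(1)}$ such that for all $i\in\omega$, $r\in\mathcal S^{(n)}_A$: if $\{k(i,t):t\in\omega\}$ is the extended graph of $r$, then $r=\theta_{v(i)}$. *)

(* Defs.v *)
From mathcomp Require Import all_boot.
From mathcomp Require Import boolp classical_sets functions cardinality.

Set Implicit Arguments.
Unset Strict Implicit.
Unset Printing Implicit Defensive.

Local Open Scope classical_set_scope.

(* Programs for the n-ary partial recursive functions. *)
Inductive rec_code : nat -> Type :=
| RZero n : rec_code n
| RSucc : rec_code 1
| RProj n (i : 'I_n) : rec_code n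
| RComp n m (g : rec_code m) (f : 'I_m -> rec_code n) : rec_code n
| RPrec n (g : rec_code n) (h : rec_code n.+2) : rec_code n.+1
| RMu n (f : rec_code n.+1) : rec_code n.

(* [rec_eval c x y]: the program c halts on the input x with the output y.
   Primitive recursion is on the first argument:
     F(0, x) = g(x)  and  F(t + 1, x) = h(t, F(t, x), x);
   minimization is on the first argument too, and requires all the values
   below the minimum to be defined (and nonzero). *)
Fixpoint rec_eval n (c : rec_code n) : n.-tuple nat -> nat -> Prop :=
  match c in rec_code n return n.-tuple nat -> nat -> Prop with
  | RZero _ => fun _ y => y = 0
  | RSucc => fun x y => y = (thead x).+1
  | RProj _ i => fun x y => y = tnth x i
  | RComp n m g f => fun x y =>
      exists z : m.-tuple nat,
        (forall i, rec_eval (f i) x (tnth z i)) /\ rec_eval g z y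
  | RPrec n g h => fun x y =>
      (fix prec (t : nat) (y : nat) : Prop :=
         match t with
         | 0 => rec_eval g [tuple of behead x] y
         | s.+1 => exists r, prec s r /\
             rec_eval h [tuple of s :: r :: behead x] y
         end) (thead x) y
  | RMu n f => fun x y =>
      rec_eval f [tuple of y :: x] 0 /\
      forall s, s < y -> exists r, rec_eval f [tuple of s :: x] r.+1
  end.

Definition computable n : set (n.-tuple nat -> nat) :=
  [set f | exists c : rec_code n, forall x, rec_eval c x (f x)].

Definition ce_set (A : set nat) : Prop :=
  A = set0 \/ exists2 f : 1.-tuple nat -> nat, computable f & A = range f.

Definition pairing_function (p : nat * nat -> nat) : Prop :=
  [/\ bijective p,
      computable (fun z : 2.-tuple nat => p (tnth z ord0, tnth z ord_max)) &
      forall x y, x <= p (x, y) /\ y <= p (x, y)].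

(* The value on the empty sequence is irrelevant: only tuples of positive
   length are encoded. *)
Fixpoint tuple_code (p : nat * nat -> nat) (s : seq nat) : nat :=
  match s with
  | [::] => 0
  | [:: x] => x
  | x :: s' => p (x, tuple_code p s')
  end.

(* Partial functions from nat^n to nat; None stands for "undefined". *)
Definition pfunction n := n.-tuple nat -> option nat.

Definition pdom n (q : pfunction n) : set (n.-tuple nat) :=
  [set x | exists y, q x = Some y].

Definition of_total n (f : n.-tuple nat -> nat) : pfunction n :=
  fun x => Some (f x).

Definition total_computable n : set (pfunction n) :=
  (@of_total n) @` (@computable n).

Definition cube n (a : nat) : set (n.-tuple nat) :=
  [set x | forall i, tnth x i < a].

Definition Anf (A : set nat) n : set (pfunction n) :=
  [set q | pdom q = set0 \/ exists2 a, A a & pdom q = cube a].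

Definition S_class (A : set nat) n : set (pfunction n) :=
  @total_computable n `|` @Anf A n.

Definition graph (p : nat * nat -> nat) n (q : pfunction n) : set nat :=
  [set w | exists x y, q x = Some y /\ w = p (tuple_code p x, y)].

Definition extended_graph (p : nat * nat -> nat) n (q : pfunction n) : set nat :=
  [set p (tuple_code p y, 0) | y in [set: n.-tuple nat]] `|`
  [set w | exists x y, q x = Some y /\ w = p (tuple_code p x, y.+1)].

Definition numbering T (X : set T) (theta : nat -> T) : Prop :=
  range theta = X.

(* The (n+1)-ary partial function (i, x) |-> theta_i(x). *)
Definition universal n (theta : nat -> pfunction n) : pfunction n.+1 :=
  fun z => theta (thead z) [tuple of behead z].

Definition QGN_I (p : nat * nat -> nat) n (theta : nat -> pfunction n) : Prop :=
  exists2 f : 1.-tuple nat -> nat, computable f &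
    extended_graph p (universal theta) = range f.

Definition QGN_II (p : nat * nat -> nat) (A : set nat) n
    (theta : nat -> pfunction n) : Prop :=
  forall k : 2.-tuple nat -> nat, computable k ->
  exists2 v : 1.-tuple nat -> nat, computable v &
    forall i (r : pfunction n), S_class A r ->
      range (fun t => k [tuple i; t]) = extended_graph p r ->
      r = theta (v [tuple i]).

Definition quasi_Goedel_numbering (p : nat * nat -> nat) (A : set nat) n
    (theta : nat -> pfunction n) : Prop :=
  [/\ numbering (@S_class A n) theta, QGN_I p theta & QGN_II p A theta].

(* Main.v *)
(** Kleene-style diagonalization, with the numbering itself in the role of the
    universal function, so that neither a universal machine nor the recursion
    theorem is needed.  Given a hypothetical [q], let [r_i] be the function
    enumerated as follows: wait for [theta_i(i, ..., i)] to take a value [w],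
    then for [theta_{q(w)}(0, ..., 0)] to take a value [y]; then, and only then,
    give [r_i] the value [y + 1] on a fixed nonempty cube with side in [A].
    QGN II yields a computable [v] with [r_i = theta_{v(i)}].  Since
    [x |-> v(x_1)] is some [theta_i], for this [i] the wait is for
    [theta_{q(v(i))}(0, ..., 0)].  As [r_i] is in Anf, [theta_{q(v(i))}] is
    total and extends [r_i], hence takes both values [y] and [y + 1] at the
    origin. *)

Require Import Defs.
From mathcomp Require Import all_boot.
From mathcomp Require Import boolp classical_sets functions cardinality.

Set Implicit Arguments.
Unset Strict Implicit.

Local Open Scope classical_set_scope.

(** * Computable functions *)

Lemma computable_ext n (f g : n.-tuple nat -> nat) :
  f =1 g -> computable f -> computable g.
Proof. by move=> /funext ->. Qed.

Lemma computable_proj n (i : 'I_n) : computable (fun x => tnth x i).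
Proof. by exists (RProj i). Qed.

Lemma computable_comp n m (g : m.-tuple nat -> nat)
    (f : 'I_m -> n.-tuple nat -> nat) :
  computable g -> (forall i, computable (f i)) ->
  computable (fun x => g [tuple f i x | i < m]).
Proof.
move=> [cg cgP] /choice[cf cfP]; exists (RComp cg cf) => x /=.
by exists [tuple f i x | i < m]; split=> // i; rewrite tnth_mktuple.
Qed.

Lemma computable_comp1 n (g : 1.-tuple nat -> nat) (f : n.-tuple nat -> nat) :
  computable g -> computable f -> computable (fun x => g [tuple f x]).
Proof.
move=> cg cf; apply: computable_ext (computable_comp cg (fun=> cf)) => x.
by congr g; apply: eq_from_tnth => i; rewrite tnth_mktuple (ord1 i).
Qed.

Lemma computable_comp2 n (g : 2.-tuple nat -> nat)
    (f1 f2 : n.-tuple nat -> nat) :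
  computable g -> computable f1 -> computable f2 ->
  computable (fun x => g [tuple f1 x; f2 x]).
Proof.
move=> cg c1 c2.
have cf i : computable (tnth [tuple f1; f2] i).
  by case: i => [[|[|//]] lti].
apply: computable_ext (computable_comp cg cf) => x; congr g.
by apply: eq_from_tnth => i; rewrite tnth_mktuple; case: i => [[|[|//]] lti].
Qed.

Lemma computable_comp3 n (g : 3.-tuple nat -> nat)
    (f1 f2 f3 : n.-tuple nat -> nat) :
  computable g -> computable f1 -> computable f2 -> computable f3 ->
  computable (fun x => g [tuple f1 x; f2 x; f3 x]).
Proof.
move=> cg c1 c2 c3.
have cf i : computable (tnth [tuple f1; f2; f3] i).
  by case: i => [[|[|[|//]]] lti].
apply: computable_ext (computable_comp cg cf) => x; congr g.
by apply: eq_from_tnth => i; rewrite tnth_mktuple; case: i => [[|[|[|//]]] lti].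
Qed.

(** With the parameters kept apart in [F], an application only has to check a recursion equation. In
    the input of [h], position 0 holds the counter, 1 the previous value, and the parameters
    follow. *)
Lemma computable_prec n (F : nat -> n.-tuple nat -> nat)
    (h : n.+2.-tuple nat -> nat) :
  computable (F 0) -> computable h ->
  (forall t x, F t.+1 x = h [tuple of t :: F t x :: x]) ->
  computable (fun x : n.+1.-tuple nat => F (thead x) [tuple of behead x]).
Proof.
move=> [cg cgP] [ch chP] FS; exists (RPrec cg ch) => x /=.
elim: (thead x) => [|t IHt] //; exists (F t [tuple of behead x]); split=> //.
rewrite FS; set u := (X in rec_eval _ X _); set w := (X in h X).
suff -> : u = w by [].
exact: val_inj.
Qed.

(** As [f] is total, the definedness clause of minimization reduces to nonvanishing below [g x]. *)
Lemma computable_mu n (f : n.+1.-tuple nat -> nat) (g : n.-tuple nat -> nat) :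
  computable f -> (forall x, f [tuple of g x :: x] = 0) ->
  (forall x s, s < g x -> f [tuple of s :: x] != 0) -> computable g.
Proof.
move=> [c cP] fg0 fgN0; exists (RMu c) => x /=; split=> [|s /fgN0].
  by rewrite -(fg0 x).
by rewrite -lt0n => /prednK E; exists (f [tuple of s :: x]).-1; rewrite E.
Qed.

Lemma computable_succ n (f : n.-tuple nat -> nat) :
  computable f -> computable (fun x => (f x).+1).
Proof.
have cS : computable (fun x : 1.-tuple nat => (thead x).+1) by exists RSucc.
by move=> cf; apply: computable_comp1 cS cf.
Qed.

Lemma computable_cst n c : computable (fun _ : n.-tuple nat => c).
Proof. by elim: c => [|c IHc]; [exists (RZero n) | apply: computable_succ]. Qed.

Lemma computable_pred n (f : n.-tuple nat -> nat) :
  computable f -> computable (fun x => (f x).-1).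
Proof.
move=> cf.
have cP := @computable_prec 0 (fun t _ => t.-1) _ (computable_cst 0 0)
  (computable_proj (ord0 : 'I_2)) (fun _ _ => erefl).
exact: computable_comp1 cP cf.
Qed.

Lemma computable_add n (f g : n.-tuple nat -> nat) :
  computable f -> computable g -> computable (fun x => f x + g x).
Proof.
move=> cf cg.
have cD := @computable_prec 1 (fun t x => t + thead x) _
  (computable_proj (ord0 : 'I_1))
  (computable_succ (computable_proj (@Ordinal 3 1 isT)))
  (fun _ _ => erefl).
exact: computable_comp2 cD cf cg.
Qed.

Lemma computable_sub n (f g : n.-tuple nat -> nat) :
  computable f -> computable g -> computable (fun x => f x - g x).
Proof.
move=> cf cg.
(* Recursion is on the first argument, so the subtrahend comes first here; the final composition
   swaps the two back. *)
have cB : computable (fun x : 2.-tuple nat =>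
    thead [tuple of behead x] - thead x).
  apply: (@computable_prec 1 (fun t x => thead x - t)
    (fun x => (tnth x (@Ordinal 3 1 isT)).-1)).
  - by apply: computable_ext (computable_proj (ord0 : 'I_1)) => x; rewrite subn0.
  - exact/computable_pred/computable_proj.
  - by move=> t x; rewrite subnS.
exact: computable_comp2 cB cg cf.
Qed.

Lemma computable_mul n (f g : n.-tuple nat -> nat) :
  computable f -> computable g -> computable (fun x => f x * g x).
Proof.
move=> cf cg.
have cM : computable (fun x : 2.-tuple nat =>
    thead x * thead [tuple of behead x]).
  apply: (@computable_prec 1 (fun t x => t * thead x)
    (fun x => tnth x (@Ordinal 3 2 isT) + tnth x (@Ordinal 3 1 isT))).
  - exact: computable_cst.
  - by apply: computable_add; apply: computable_proj.
  - by move=> t; case/tupleP=> a x; rewrite mulSn.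
exact: computable_comp2 cM cf cg.
Qed.

Lemma computable_if_eq n (f g h k : n.-tuple nat -> nat) :
  computable f -> computable g -> computable h -> computable k ->
  computable (fun x => if f x == g x then h x else k x).
Proof.
move=> cf cg ch ck.
have cI : computable (fun x : 3.-tuple nat =>
    if thead x is 0 then thead [tuple of behead x]
    else thead [tuple of behead [tuple of behead x]]).
  apply: (@computable_prec 2
    (fun t x => if t is 0 then thead x else thead [tuple of behead x])
    (fun x => tnth x (@Ordinal 4 3 isT))).
  - exact: computable_proj.
  - exact: computable_proj.
  - by move=> t; case/tupleP=> a; case/tupleP=> b x.
(* Subtraction is truncated, so this sum is the distance of [f x] and [g x], which is 0 exactly at
   equality. *)
have cd := computable_add (computable_sub cf cg) (computable_sub cg cf).
apply: computable_ext (computable_comp3 cI cd ch ck) => x.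
rewrite [f x == g x]eqn_leq -[f x <= g x]subn_eq0 -[g x <= f x]subn_eq0.
rewrite -addn_eq0 -[thead [tuple _; _; _]]/(f x - g x + (g x - f x)).
by case: (_ + _).
Qed.

(** The list is fixed, so membership unfolds into a finite chain of equality tests. *)
Lemma computable_if_mem n (L : seq nat) (f h k : n.-tuple nat -> nat) :
  computable f -> computable h -> computable k ->
  computable (fun x => if f x \in L then h x else k x).
Proof.
move=> cf ch ck; elim: L => // a L IHL.
have := computable_if_eq cf (computable_cst n a) ch IHL.
by apply: computable_ext => x; rewrite inE; case: eqP.
Qed.

(* With [s] the integer square root of [t], the maps [t |-> t - s ^ 2] and
   [t |-> s - (t - s ^ 2)] send [(a + b) ^ 2 + a] to [a] and [b]; a single
   minimization computes them. *)
Lemma computable_unpairing : exists u v : 1.-tuple nat -> nat,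
  [/\ computable u, computable v &
      forall a b, exists t, u [tuple t] = a /\ v [tuple t] = b].
Proof.
have ex t : exists s, t < s.+1 * s.+1 by exists t; rewrite mulnS ltn_addr.
pose s (x : 1.-tuple nat) := ex_minn (ex (thead x)).
have c_id : computable (fun x : 1.-tuple nat => thead x).
  exact: computable_proj.
have cs : computable s.
  pose fs (x : 2.-tuple nat) :=
    (tnth x ord_max).+1 - (tnth x ord0).+1 * (tnth x ord0).+1.
  apply: (@computable_mu 1 fs).
  - apply: computable_sub; first exact/computable_succ/computable_proj.
    by apply: computable_mul; apply/computable_succ/computable_proj.
  - case/tupleP=> t x; rewrite /fs /s; case: ex_minnP => m.
    by rewrite -subn_eq0 => /eqP.
  - case/tupleP=> t x r; rewrite /fs /s; case: ex_minnP => m _ min_m ltrm.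
    rewrite subn_eq0; apply: contraL ltrm => ltr.
    by rewrite -leqNgt min_m.
pose u x := thead x - s x * s x.
have cu : computable u by apply: computable_sub => //; apply: computable_mul.
exists u, (fun x => s x - u x); split=> // [|a b].
  exact: computable_sub.
exists ((a + b) * (a + b) + a).
suff sE : s [tuple (a + b) * (a + b) + a] = a + b.
  have uE : u [tuple (a + b) * (a + b) + a] = a by rewrite /u sE addKn.
  by rewrite uE sE addKn.
rewrite /s; case: ex_minnP => m; rewrite -[thead _]/((a + b) * (a + b) + a).
(* From [a <= d] it follows that [d * d + a] lies below [d.+1 * d.+1], so its integer square root is
   [d]. *)
move: (a + b) (leq_addr b a) => d le_ad lt_m min_m.
apply/eqP; rewrite eqn_leq min_m /=; last first.
  by rewrite mulnS mulSn addSn ltnS [leqLHS]addnC leq_add ?leq_addl.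
rewrite -ltnS -ltn_sqr -!mulnn; apply: leq_ltn_trans lt_m; exact: leq_addr.
Qed.

(** Lets one search parameter carry several guesses: [u i] iterates the second unpairing map [i]
    times and then takes the first. *)
Lemma computable_decoding : exists u : nat -> 1.-tuple nat -> nat,
  (forall i, computable (u i)) /\
  forall l : seq nat, exists t,
    forall i, i < size l -> u i [tuple t] = nth 0 l i.
Proof.
have [u [v [cu cv uvP]]] := computable_unpairing.
pose d := fix d i (x : 1.-tuple nat) :=
  if i is j.+1 then d j [tuple v x] else u x.
exists d; split=> [|l].
  by elim=> [|i IHi] //=; apply: computable_comp1 IHi cv.
elim: l => [|a l [t tP]]; first by exists 0.
have [t' [ut' vt']] := uvP a t.
by exists t' => -[|i] //= lti; rewrite vt' tP.
Qed.

(** * Tuple codes and enumerations *)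

Lemma tuple_code_cons (p : nat * nat -> nat) n a (x : n.+1.-tuple nat) :
  tuple_code p (a :: x) = p (a, tuple_code p x).
Proof. by case/tupleP: x. Qed.

Lemma tuple_code_inj (p : nat * nat -> nat) n :
  injective p -> injective (fun x : n.-tuple nat => tuple_code p x).
Proof.
move=> p_inj; elim: n => [|n IHn]; first by move=> x y _; rewrite (tuple0 x) (tuple0 y).
case/tupleP=> a x; case/tupleP=> b y; case: n => [|n] in x y IHn *.
  by rewrite (tuple0 x) (tuple0 y) /= => ->.
by rewrite !tuple_code_cons => /p_inj[-> /IHn ->].
Qed.

Lemma tuple_code_surj (p : nat * nat -> nat) n j :
  bijective p -> exists x : n.+1.-tuple nat, tuple_code p x = j.
Proof.
case=> p' _ p'K; elim: n j => [|n IHn] j; first by exists [tuple j].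
have [x xP] := IHn (p' j).2; exists [tuple of (p' j).1 :: x].
rewrite tuple_code_cons xP.
by rewrite -surjective_pairing p'K.
Qed.

Lemma computable_pairing (p : nat * nat -> nat) n (f g : n.-tuple nat -> nat) :
  pairing_function p -> computable f -> computable g ->
  computable (fun x => p (f x, g x)).
Proof. by case=> _ cp _ cf cg; apply: computable_comp2 cp cf cg. Qed.

Lemma computable_tuple_code_nseq (p : nat * nat -> nat) m n
    (f : n.-tuple nat -> nat) :
  pairing_function p -> computable f ->
  computable (fun x => tuple_code p (nseq m.+1 (f x))).
Proof.
by move=> hp cf; elim: m => [|m IHm] //; apply: computable_pairing.
Qed.

(** The cube is finite, so its codes form a list that [computable_if_mem] can test. *)
Lemma cube_codes (p : nat * nat -> nat) n a : injective p ->
  exists L : seq nat, forall x : n.-tuple nat,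
    tuple_code p x \in L <-> cube a x.
Proof.
move=> p_inj.
exists [seq tuple_code p [tuple of map val t] | t : n.-tuple 'I_a] => x.
split=> [/mapP[t _ /(tuple_code_inj p_inj) ->] i|xa].
  by rewrite tnth_map ltn_ord.
apply/mapP; exists [tuple Ordinal (xa i) | i < n]; first by rewrite mem_enum.
congr tuple_code; congr tval; apply: eq_from_tnth => i.
by rewrite tnth_map tnth_mktuple.
Qed.

(** Positive second components separate recorded values from the default entries, so convergence is
    witnessed by a stage [s] of the enumeration. *)
Lemma range_enumeration (p : nat * nat -> nat) n
    (theta : nat -> pfunction n) (f : 1.-tuple nat -> nat) i
    (x : n.-tuple nat) y :
  injective p -> extended_graph p (universal theta) = range f ->
  theta i x = Some y <->
  exists s, f [tuple s] = p (tuple_code p (i :: x), y.+1).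
Proof.
move=> p_inj fP; split=> [ixy|[s fs]].
  have : extended_graph p (universal theta)
      (p (tuple_code p (i :: x), y.+1)).
    right; exists [tuple of i :: x], y; split=> //.
    by rewrite /universal; congr (theta _ _ = _): ixy; apply: val_inj.
  rewrite fP => -[z _ <-]; exists (thead z); congr f.
  by apply: eq_from_tnth => j; rewrite (ord1 j).
have : range f (f [tuple s]) by exists [tuple s].
rewrite -fP fs => -[[z _ /p_inj[]] //|[z [y' [zy /p_inj[zE yE]]]]].
have zix := @tuple_code_inj p n.+1 p_inj [tuple of i :: x] z zE.
rewrite yE -zy -zix /universal; congr (theta _ _).
exact: val_inj.
Qed.

(** * Diagonalization against [q] *)

Theorem theorem4p17 (p : nat * nat -> nat) (hp : pairing_function p)
    (A : set nat) (A_inf : infinite_set A) (A_ce : ce_set A)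
    (n : nat) (n_ge1 : 1 <= n)
    (theta : nat -> pfunction n) (htheta : quasi_Goedel_numbering p A theta) :
  ~ exists q : 1.-tuple nat -> nat, computable q /\
      forall i : nat, Anf A (theta i) ->
        total_computable (theta (q [tuple i])) /\
        graph p (theta i) `<=` graph p (theta (q [tuple i])).
Proof.
case: n => [//|n] in n_ge1 theta htheta *.
case=> q [cq qP]; have [theta_num [f cf fP] theta_II] := htheta.
have [p_bij _ _] := hp; have p_inj := bij_inj p_bij.
have thetaP i x y := @range_enumeration p _ theta f i x y p_inj fP.
(* A positive side puts the origin into the cube. *)
have [a Aa a_gt0] : exists2 a, A a & 0 < a.
  apply: contra_notP A_inf => noA; apply: (@sub_finite_set _ _ [set 0]) => //.
  by case=> // b Ab; case: noA; exists b.+1.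
have [L LP] := @cube_codes p n.+1 a p_inj.
have [u [cu u_nth]] := computable_decoding.
have uP s s' w y j : exists t, [/\ u 0 [tuple t] = s, u 1 [tuple t] = s',
    u 2 [tuple t] = w, u 3 [tuple t] = y & u 4 [tuple t] = j].
  by have [t tP] := u_nth [:: s; s'; w; y; j]; exists t; split; rewrite tP.
(* [d 0] and [d 1] are stages of [f] certifying the guessed values [d 2] and [d 3] of the two
   awaited computations; [d 4] codes the argument. A failed test emits the default entry. In
   [(d 3).+2] one successor is the diagonal shift, the other belongs to the extended graph. *)
pose k (x : 2.-tuple nat) :=
  let i := tnth x ord0 in let d j := u j [tuple tnth x ord_max] in
  if f [tuple d 0] == p (tuple_code p (nseq n.+2 i), (d 2).+1) then
    if f [tuple d 1] ==
       p (p (q [tuple d 2], tuple_code p (nseq n.+1 0)), (d 3).+1)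
    then if d 4 \in L then p (d 4, (d 3).+2) else p (d 4, 0)
    else p (d 4, 0)
  else p (d 4, 0).
have ck : computable k.
  have cd j : computable (fun x : 2.-tuple nat => u j [tuple tnth x ord_max]).
    exact: computable_comp1 (cu j) (computable_proj _).
  have cd0 : computable (fun x : 2.-tuple nat =>
      p (u 4 [tuple tnth x ord_max], 0)).
    exact: computable_pairing (computable_cst _ 0).
  apply: computable_if_eq => //.
  - exact: computable_comp1 cf (cd 0).
  - apply: computable_pairing (computable_succ (cd 2)) => //.
    exact: computable_tuple_code_nseq (computable_proj _).
  apply: computable_if_eq => //.
  - exact: computable_comp1 cf (cd 1).
  - apply: computable_pairing (computable_succ (cd 3)) => //.
    apply: computable_pairing (computable_cst _ _) => //.
    exact: computable_comp1 cq (cd 2).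
  apply: computable_if_mem => //.
  exact: computable_pairing (computable_succ (computable_succ (cd 3))).
have [v cv vP] := theta_II k ck.
have [i iP] : exists i, theta i = of_total (fun x => v [tuple thead x]).
  have : range theta (of_total (fun x : n.+1.-tuple nat => v [tuple thead x])).
    rewrite theta_num; left; exists (fun x => v [tuple thead x]) => //.
    exact: computable_comp1 cv (computable_proj ord0).
  by case=> i _ iP; exists i.
pose w := v [tuple i]; pose o := [tuple of nseq n.+1 0].
(* Hence every guess [d 2] that passes the first test for this [i] equals [w]. *)
have thetaiP w' : theta i [tuple of nseq n.+1 i] = Some w' <-> w' = w.
  by rewrite iP /of_total; split=> [[<-]|->].
pose r : pfunction n.+1 := fun x =>
  if tuple_code p x \in L then omap S (theta (q [tuple w]) o) else None.
have Lo : tuple_code p o \in L.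
  by apply/LP => j; rewrite tnth_nseq.
(* Convergence of [theta (q [tuple w])] at [o] is not yet known, since [qP] presupposes
   [Anf A (theta w)]; divergence gives the empty domain. *)
have Anf_r : Anf A r.
  case E : (theta (q [tuple w]) o) => [y|]; [right; exists a => // | left].
    apply/seteqP; split=> x.
      by case=> z; rewrite /r; case: ifP => // /LP.
    by move=> /LP xL; exists y.+1; rewrite /r xL E.
  by apply/seteqP; split=> x // -[z]; rewrite /r E; case: ifP.
have rP : range (fun t => k [tuple i; t]) = extended_graph p r.
  have kE t : k [tuple i; t] =
      if [&& f [tuple u 0 [tuple t]] ==
              p (tuple_code p (i :: nseq n.+1 i), (u 2 [tuple t]).+1),
            f [tuple u 1 [tuple t]] ==
              p (tuple_code p (q [tuple u 2 [tuple t]] :: o), (u 3 [tuple t]).+1)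
          & u 4 [tuple t] \in L]
      then p (u 4 [tuple t], (u 3 [tuple t]).+2) else p (u 4 [tuple t], 0).
    by rewrite /k -[tnth _ ord0]/i -[tnth _ ord_max]/t; do 2![case: eqP => _ //].
  apply/seteqP; split=> [_ [t _ <-]|z].
    rewrite kE; have [x xE] := @tuple_code_surj p n (u 4 [tuple t]) p_bij.
    case: ifP => [/and3P[/eqP f0 /eqP f1 dL]|_]; last first.
      by left; exists x; rewrite ?xE.
    right; exists x, (u 3 [tuple t]).+1; split; last by rewrite xE.
    have /thetaiP wE : theta i [tuple of nseq n.+1 i] = Some (u 2 [tuple t]).
      by apply/thetaP; exists (u 0 [tuple t]).
    suff -> : r x = omap S (Some (u 3 [tuple t])) by [].
    rewrite /r xE dL; congr omap; apply/thetaP.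
    by exists (u 1 [tuple t]); rewrite f1 wE.
  case=> [[x _ <-]|[x [y [rxy ->]]]].
    (* Default entries are due inside the cube too, so a failing test is needed: stage 0 of [f]
       cannot match both guesses 0 and 1. *)
    have [w' w'P] : exists w', f [tuple 0] !=
        p (tuple_code p (i :: nseq n.+1 i), w'.+1).
      have [E|?] := eqVneq (f [tuple 0])
        (p (tuple_code p (i :: nseq n.+1 i), 1)); last by exists 0.
      by exists 1; rewrite E; apply/eqP => /p_inj[].
    have [t [u0 u1 u2 u3 u4]] := uP 0 0 w' 0 (tuple_code p x).
    by exists t => //; rewrite kE u0 u2 u4 (negPf w'P).
  move: rxy; rewrite /r; case: ifP => // xL.
  case E : (theta _ o) => [y'|//] [<-].
  have /thetaP[s' fs'] := E.
  have /thetaP[s fs] : theta i [tuple of nseq n.+1 i] = Some w by apply/thetaiP.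
  have [t [u0 u1 u2 u3 u4]] := uP s s' w y' (tuple_code p x).
  by exists t => //; rewrite kE u0 u1 u2 u3 u4 fs fs' !eqxx xL.
have rE : r = theta w by apply: vP rP; right.
have Anf_w : Anf A (theta w) by rewrite -rE.
have [[g _ gE] rsub] := qP w Anf_w.
have E : theta (q [tuple w]) o = Some (g o) by rewrite -gE.
have : graph p (theta w) (p (tuple_code p o, (g o).+1)).
  by exists o, (g o).+1; rewrite -rE /r Lo E.
move=> /rsub[x [y [xy /p_inj[oxE yE]]]].
have oE := @tuple_code_inj p n.+1 p_inj o x oxE.
by move: xy; rewrite -oE E -yE => -[] /n_Sn.
Qed.
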